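(* There is an absolute constant $C>0$ and an adaptive (possibly randomized) arm-pulling algorithm which, given inputs $n\ge 2$, $1\le K\le n-1$, $\epsilon\in(0,1]$ and $\delta\in(0,1/2]$, has the following guarantee for every instance with $n$ arms whose reward distributions are supported on $[0,1]$: with probability at least $1-\delta$, the algorithm outputs an $\epsilon$-top-$K$ set of arms and the total number of pulls it makes is at most $$C\left(\log\log\frac{4}{\Delta_t^{\epsilon}}+\log n+\log\frac1\delta\right)\sum_{i=1}^{n}\min\{\Delta_i^{-2},(\Delta_t^{\epsilon})^{-2}\},$$ where $t\in\{0,1,\dots,K-1\}$ is the largest integer satisfying $\Delta_{K-t}\cdot t\le K\epsilon$, and $\Delta_t^{\epsilon}=\max(\epsilon,\Delta_{K-t})$.
   Context: Stochastic $n$-armed bandit model: arm $i\in[n]$ has an unknown reward distribution $\mathcal D_i$ supported on $[0,1]$ with mean $\theta_i$; arms are indexed so that $\theta_1\ge\theta_2\ge\dots\ge\theta_n$ (this indexing is unknown to the algorithm). An algorithm sequentially and adaptively chooses an arm to pull; each pull of arm $i$ yields an independent sample from $\mathcal D_i$. The algorithm knows its input parameters but not the distributions, and at the end outputs a set of arms. For a set $T\subseteq[n]$ with $|T|=K$, the aggregate regret is $\mathcal R_T=\frac1K\left(\sum_{i=1}^K\theta_i-\sum_{i\in T}\theta_i\right)$; $T$ is an $\epsilon$-top-$K$ set if $|T|=K$ and $\mathcal R_T\le\epsilon$. Gaps: $\Delta_i=\theta_i-\theta_{K+1}$ if $i\le K$, and $\Delta_i=\theta_K-\theta_i$ if $i\ge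 K+1$ (with the convention $\Delta_i^{-2}=+\infty$ if $\Delta_i=0$). *)

(* Defs.v *)
From HB Require Import structures.
From mathcomp Require Import all_boot all_order all_algebra.
From mathcomp Require Import all_classical all_reals.
From mathcomp Require Import topology normedtype sequences exp measure
  lebesgue_measure lebesgue_integral probability.


Set Implicit Arguments.
Unset Strict Implicit.
Unset Printing Implicit Defensive.

Import Order.TTheory GRing.Theory Num.Theory.
Local Open Scope classical_set_scope.
Local Open Scope ring_scope.

Section Defs.
Variable R : realType.

Definition mutually_independent d (Omega : measurableType d)
  (P : probability Omega R) (I : eqType) (Y : I -> {RV P >-> R}) : Prop :=
  forall (F : seq I) (B : I -> set R), uniq F ->
    (forall a, measurable (B a)) ->
    P (\bigcap_(a in [set a | a \in F]) (Y a @^-1` B a)) =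
    (\prod_(a <- F) P (Y a @^-1` B a))%E.

Inductive action (n : nat) : Type :=
| Pull of 'I_n
| Stop of {set 'I_n}.

(** A (possibly randomized) adaptive algorithm: given n, K, epsilon, delta,
    an internal random seed u (drawn uniformly from [0,1], independently of
    everything else), and the history of (arm pulled, reward observed) pairs
    so far, it decides the next action. *)
Definition algorithm : Type :=
  forall n : nat, nat -> R -> R -> R -> seq ('I_n * R) -> action n.

(** Execution of a policy against a reward table r: the j-th pull of arm i
    (counting from 0) returns r i j.  hist k is the history after k rounds;
    once the policy stops, the history no longer changes. *)
Fixpoint run_hist (n : nat) (pol : seq ('I_n * R) -> action n)
  (r : 'I_n -> nat -> R) (k : nat) : seq ('I_n * R) :=
  match k with
  | 0 => [::]
  | k'.+1 =>
      let h := run_hist pol r k' in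
      match pol h with
      | Pull i => rcons h (i, r i (count (fun p => p.1 == i) h))
      | Stop _ => h
      end
  end.

(** Means sorted in nonincreasing order; sorted_mean th k (1-indexed)
    is theta_k in the paper's indexing. *)
Definition sorted_mean (n : nat) (th : 'I_n -> R) (k : nat) : R :=
  nth 0 (sort (fun x y : R => y <= x) [seq th i | i <- enum 'I_n]) k.-1.

Definition gap (n K : nat) (th : 'I_n -> R) (k : nat) : R :=
  if (k <= K)%N then sorted_mean th k - sorted_mean th K.+1
  else sorted_mean th K - sorted_mean th k.

Definition agg_regret (n K : nat) (th : 'I_n -> R) (T : {set 'I_n}) : R :=
  (K%:R)^-1 * (\sum_(1 <= k < K.+1) sorted_mean th k - \sum_(i in T) th i).

Definition eps_topK (n K : nat) (eps : R) (th : 'I_n -> R) (T : {set 'I_n}) :=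
  #|T| = K /\ agg_regret K th T <= eps.

Definition t_param (n K : nat) (eps : R) (th : 'I_n -> R) : nat :=
  \max_(t < K | gap K th (K - t) * t%:R <= K%:R * eps) (t : nat).

Definition Delta_eps (n K : nat) (eps : R) (th : 'I_n -> R) : R :=
  Num.max eps (gap K th (K - t_param K eps th)).

(** min{Delta_k^-2, (Delta^eps)^-2}, with Delta_k^-2 = +oo when Delta_k = 0. *)
Definition cost_term (n K : nat) (eps : R) (th : 'I_n -> R) (k : nat) : R :=
  let D := Delta_eps K eps th in
  if gap K th k == 0 then D ^- 2 else Num.min (gap K th k ^- 2) (D ^- 2).

Definition sample_bound (C : R) (n K : nat) (eps delta : R)
  (th : 'I_n -> R) : R :=
  C * (ln (ln (4 / Delta_eps K eps th)) + ln n%:R + ln delta^-1) *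
  \sum_(1 <= k < n.+1) cost_term K eps th k.

End Defs.
Arguments mutually_independent {R d Omega} P {I} Y.

(* Main.v *)
(** Successive elimination with halving accuracies. In round [r] every undecided
    arm is sampled until it has [quota r] pulls, of order [4^r ln(n r^2 / delta)],
    so that by a Chernoff bound and a union bound all the estimates used are
    within [2^-r] of the means, except with probability [delta]. An arm is then
    accepted (rejected) when counting the arms that could beat it (that surely
    beat it) forces it into (out of) the top [K]; an arm with gap above
    [4 * 2^-r] does not survive. As soon as [2 * 2^-r * k <= K eps], where [k] is
    the number of places still open, the [k] best estimates complete the output:
    each place costs a regret of at most [2 * 2^-r].

    Once [4 * 2^-r] is below [Delta_(K-t)], only [t] places can be open, and
    [t * Delta_(K-t) <= K eps] triggers the stop. Hence in every round that is
    played, [2^-r] is at least of the order of [Delta_t^eps], and also of the gap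
    of every arm still undecided. As quotas are cumulative, the last round in
    which an arm is played bounds all of its pulls. *)
Require Import Defs.
From HB Require Import structures.
From mathcomp Require Import all_boot all_order all_algebra.
From mathcomp Require Import all_classical all_reals.
From mathcomp Require Import topology normedtype sequences exp measure
  lebesgue_measure lebesgue_integral probability.
From mathcomp Require Import measurable_realfun numfun ereal ring lra.
Import Order.TTheory GRing.Theory Num.Theory.
Local Open Scope classical_set_scope.
Local Open Scope ring_scope.

(** * Concentration *)

Section product_expectation.
Local Open Scope ereal_scope.
Import HBNNSimple.

(** Linearity extends the identity from indicators to simple functions, and monotone convergence to
    nonnegative measurable ones. In the application [G] is a product over variables other than [Y]
    and [c] is its expectation; finiteness lets [c] pass through the limit. *)
Lemma integral_indic_extend {R : realType} {d : measure_display}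
    {T : measurableType d} (mu : {measure set T -> \bar R})
    (Y : T -> R) (G : T -> R) (c : \bar R) (f : R -> R) :
  measurable_fun setT Y -> measurable_fun setT G -> (forall w, (0 <= G w)%R) ->
  c \is a fin_num ->
  (forall B : set R, measurable B ->
    \int[mu]_w (G w * \1_B (Y w))%:E = c * mu (Y @^-1` B)) ->
  measurable_fun setT f -> (forall x, (0 <= f x)%R) ->
  \int[mu]_w (G w * f (Y w))%:E = c * \int[mu]_w (f (Y w))%:E.
Proof.
move=> mY mG G0 cfin GB mf f0.
have mfE : measurable_fun setT (EFin \o f) by exact/measurable_EFinP.
pose h := nnsfun_approx measurableT mfE.
have hf x : (h n x)%:E @[n --> \oo] --> (f x)%:E.
  by apply: (cvg_nnsfun_approx measurableT mfE) => // ? _ /=; rewrite lee_fin.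
have hnd x a b : (a <= b)%N -> (h a x <= h b x)%R.
  by move=> ab; exact/lefP/nd_nnsfun_approx.
have mhY n : measurable_fun setT (fun w => h n (Y w)).
  by apply: measurableT_comp mY; exact: measurable_funP.
have mInd n y : measurable_fun setT (fun w => \1_(h n @^-1` [set y]) (Y w) : R).
  by apply: measurableT_comp mY; exact: measurable_indic.
have key n : \int[mu]_w (G w * h n (Y w))%:E = c * \int[mu]_w (h n (Y w))%:E.
  have hE w : (h n (Y w))%:E =
      \sum_(y \in range (h n)) (y * \1_(h n @^-1` [set y]) (Y w))%:E.
    by rewrite fimfunE -fsumEFin.
  have pos y w : 0 <= (y * \1_(h n @^-1` [set y]) (Y w))%:E.
    by rewrite EFinM nnfun_muleindic_ge0.
  have my y : measurable_fun setT (fun w => (y * \1_(h n @^-1` [set y]) (Y w))%R).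
    exact: measurable_funM.
  transitivity (\int[mu]_w \sum_(y \in range (h n))
      ((G w)%:E * (y * \1_(h n @^-1` [set y]) (Y w))%:E)).
    by apply: eq_integral => w _; rewrite EFinM hE ge0_mule_fsumr.
  rewrite ge0_integral_fsum//; last 2 first.
  - by move=> y; apply/measurable_EFinP; exact: measurable_funM.
  - by move=> y w _; apply: mule_ge0 => //; rewrite lee_fin.
  under [in RHS]eq_integral do rewrite hE.
  rewrite ge0_integral_fsum//; last by move=> y; exact/measurable_EFinP.
  rewrite ge0_mule_fsumr; last by move=> y; apply: integral_ge0.
  apply: eq_fsbigr => y /set_mem[x _ xy].
  have y0 : (0 <= y)%R by rewrite -xy.
  under eq_integral do rewrite -EFinM mulrCA EFinM.
  rewrite ge0_integralZl//; last 2 first.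
  - by apply/measurable_EFinP; exact: measurable_funM.
  - by move=> w _; rewrite lee_fin mulr_ge0.
  rewrite GB//; under [in RHS]eq_integral do rewrite EFinM.
  rewrite ge0_integralZl//; last exact/measurable_EFinP.
  rewrite (_ : \int[mu]_w _ = mu (Y @^-1` (h n @^-1` [set y]))); first by rewrite muleCA.
  rewrite -[in RHS](setIT (Y @^-1` _)) -integral_indic//.
  by rewrite -[X in measurable X]setTI; exact: mY.
transitivity (limn (fun n => \int[mu]_w (G w * h n (Y w))%:E)).
  rewrite -monotone_convergence//=.
  - apply: eq_integral => w _; apply/esym/cvg_lim => //; rewrite EFinM.
    rewrite (_ : (fun n => _) = (fun n => (G w)%:E * (h n (Y w))%:E)).
      by apply: cvgeZl.
    by apply/funext => n; rewrite EFinM.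
  - by move=> n; apply/measurable_EFinP; exact: measurable_funM.
  - by move=> n w _; rewrite lee_fin mulr_ge0.
  - by move=> w _ a b ab; rewrite lee_fin ler_wpM2l// hnd.
rewrite (_ : \int[mu]_w (f (Y w))%:E = limn (fun n => \int[mu]_w (h n (Y w))%:E)).
  rewrite -limeMl//; first by congr (limn _); apply/funext => n.
  apply: ereal_nondecreasing_is_cvgn => a b ab; apply: ge0_le_integral => //.
  - by move=> x _; rewrite lee_fin.
  - exact/measurable_EFinP.
  - exact/measurable_EFinP.
  - by move=> x _; rewrite lee_fin hnd.
rewrite -monotone_convergence//=.
- by apply: eq_integral => w _; apply/esym/cvg_lim.
- by move=> n; exact/measurable_EFinP.
- by move=> n w _; rewrite lee_fin.
- by move=> w _ a b ab; rewrite lee_fin hnd.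
Qed.

(** Lifts independence, which is stated on events, to the factorization of expectations that a
    Chernoff bound uses. *)
Lemma expectation_prod_indep {R : realType} {d : measure_display}
    {T : measurableType d} (P : probability T R) (I : eqType)
    (Y : I -> {RV P >-> R}) (f : I -> R -> R) (F : seq I) :
  mutually_independent P Y -> uniq F ->
  (forall a, measurable_fun setT (f a)) -> (forall a x, (0 <= f a x)%R) ->
  (forall a, a \in F -> \int[P]_w (f a (Y a w))%:E \is a fin_num) ->
  \int[P]_w (\prod_(a <- F) f a (Y a w))%:E =
    \prod_(a <- F) \int[P]_w (f a (Y a w))%:E.
Proof.
move=> ind uF mf f0 ffin.
(* Sets are replaced by functions one factor at a time. *)
suff main F1 F2 (B : I -> set R) : uniq (F1 ++ F2) ->
    {subset F1 <= F} -> (forall a, measurable (B a)) ->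
    \int[P]_w (\prod_(a <- F1) f a (Y a w) * \prod_(a <- F2) \1_(B a) (Y a w))%:E
    = (\prod_(a <- F1) \int[P]_w (f a (Y a w))%:E) *
      \prod_(a <- F2) P (Y a @^-1` B a).
  have := main F [::] (fun=> setT); rewrite cats0 big_nil mule1 => <- //.
  by apply: eq_integral => w _; rewrite big_nil mulr1.
have mprod (s : seq I) (g : I -> R -> R) : (forall a, measurable_fun setT (g a)) ->
    measurable_fun setT (fun w => (\prod_(a <- s) g a (Y a w))%R).
  move=> mg; elim: s => [|a s IH].
    by under eq_fun do rewrite big_nil; exact: measurable_cst.
  under eq_fun do rewrite big_cons.
  by apply: measurable_funM => //; apply: measurableT_comp.
elim: F1 F2 B => [|a F1 IH] F2 B /= u F1F mB.
  rewrite big_nil mul1e -ind//.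
  under eq_integral do rewrite big_nil mul1r.
  rewrite -[in RHS](setIT (\bigcap_(a in _) _)) -integral_indic//; last first.
    apply: fin_bigcap_measurable => [|a _]; first exact: finite_seq.
    by rewrite -[X in measurable X]setTI; exact: measurable_funP.
  apply: eq_integral => w _; congr EFin; rewrite indicE.
  have [/set_mem wF|wF] := boolP (w \in _).
    rewrite big_seq big1// => a aF; rewrite indicE mem_set//; exact: wF.
  apply/eqP; rewrite prodf_seq_eq0; apply/hasP.
  move: wF; rewrite notin_setE /bigcap/= => /existsNP[a /not_implyP[aF nB]].
  by exists a => //=; rewrite indicE memNset.
have F1F' : {subset F1 <= F} by move=> b bF1; apply: F1F; rewrite inE bF1 orbT.
have aF' : a \in F by apply: F1F; rewrite inE eqxx.
have /andP[aF u'] : (a \notin F1 ++ F2) && uniq (F1 ++ F2) by exact: u.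
have uu : uniq (F1 ++ a :: F2) by rewrite -cat1s uniq_catCA.
under eq_integral do rewrite big_cons -mulrA mulrC.
rewrite (@integral_indic_extend _ _ _ P (Y a) _
  ((\prod_(b <- F1) \int[P]_w (f b (Y b w))%:E) * \prod_(b <- F2) P (Y b @^-1` B b)))//.
- by rewrite big_cons [LHS]muleC muleA.
- apply: measurable_funM; first exact: mprod.
  by apply: (mprod _ (fun b => \1_(B b))) => b; exact: measurable_indic.
- move=> w; apply: mulr_ge0; apply: prodr_ge0 => b _; rewrite ?f0// indicE.
- rewrite fin_numM//; first by rewrite big_seq prode_fin_num// => b /F1F' /ffin.
  apply: prode_fin_num => b _; apply: fin_num_measure.
  by rewrite -[X in measurable X]setTI; exact: measurable_funP.
(* The variable [a] moves to the front of [F2] with an arbitrary set [A] attached; the induction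
   hypothesis for this longer [F2] is the identity on indicators that the extension lemma asks
   for. *)
- move=> A mA; pose B' b := if b == a then A else B b.
  have B'F2 b : b \in F2 -> B' b = B b.
    rewrite /B'; case: eqP => // -> aF2.
    by move: aF; rewrite mem_cat aF2 orbT.
  transitivity (\int[P]_w (\prod_(b <- F1) f b (Y b w)
      * \prod_(b <- a :: F2) \1_(B' b) (Y b w))%:E).
    apply: eq_integral => w _; rewrite big_cons {1}/B' eqxx -mulrA [(\1_A _ * _)%R]mulrC.
    congr (_ * (_ * _))%:E; apply: eq_big_seq => b bF2; by rewrite B'F2.
  rewrite IH//; last by move=> b; rewrite /B'; case: ifP.
  rewrite big_cons {1}/B' eqxx [X in _ * X]muleC muleA.
  congr (_ * _ * _); apply: eq_big_seq => b bF2; by rewrite B'F2.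
Qed.
End product_expectation.

(** Inverting [1 - y <= expR (- y)] leaves [1 <= (1 - y) * (1 + y + 2 * y ^+ 2)], whose right side
    is [1 + y ^+ 2 * (1 - 2 * y)]. *)
Lemma expR_le_quad {R : realType} (y : R) : `|y| <= 1 / 2 -> expR y <= 1 + y + 2 * y ^+ 2.
Proof.
rewrite ler_norml => /andP[y1 y2].
have h : 0 < 1 - y by lra.
have e1 : 1 - y <= expR (- y) by rewrite -[1 - y]/(1 + - y); exact: expR_ge1Dx.
have : expR y <= (1 - y)^-1.
  by rewrite -[y in expR y]opprK expRN lef_pV2// posrE expR_gt0.
move=> /le_trans; apply; rewrite -[_^-1]mul1r ler_pdivrMr//; nra.
Qed.

Lemma integral_conull {R : realType} {d : measure_display}
    {T : measurableType d} (P : probability T R) (A : set T) (f : T -> \bar R) :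
  measurable A -> P A = 1%E -> measurable_fun setT f ->
  (\int[P]_x f x = \int[P]_(x in A) f x)%E.
Proof.
move=> mA PA mf; rewrite [RHS]integral_mkcond; apply: ae_eq_integral => //.
  exact/(measurable_restrictT _ mA)/(measurable_funS _ _ mf).
exists (~` A); split; first exact: measurableC.
  by have := probability_setC P mA; rewrite PA subee.
by move=> x; apply: contra_not => Ax _; rewrite patchE mem_set.
Qed.

(** * Mean and exponential moments of a law on the unit interval *)

Section unit_interval.
Context {R : realType} (D : probability R R).
Hypothesis D01 : D `[0, 1]%classic = 1%E.
Let mean := fine (\int[D]_x (x%:E))%E.
Let I01 := `[0, 1]%classic : set R.

Let DI01 : (D : {measure set R -> \bar R}) I01 = 1%E. Proof. exact: D01. Qed.

Let integrable01 (f : R -> R) : measurable_fun setT f ->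
  [bounded f x | x in I01] -> D.-integrable I01 (EFin \o f).
Proof.
move=> mf bf; apply: measurable_bounded_integrable => //.
- exact: measurable_itv.
- by rewrite DI01 ltry.
- exact: measurable_funTS.
Qed.

Let integrable_cst c : D.-integrable I01 (EFin \o cst c).
Proof.
apply: integrable01 => //; exists `|c|; split => // x cx y _ /=; exact: ltW.
Qed.

Let integrable_id : D.-integrable I01 (EFin \o id).
Proof.
apply: integrable01 => //; exists 1; split => // x cx y; rewrite /I01/= in_itv/=.
by move=> /andP[y0 y1]; rewrite ger0_norm// (le_trans y1)// ltW.
Qed.

Let meanE : mean = (\int[D]_(x in I01) x)%R.
Proof.
by rewrite /mean /Rintegral (@integral_conull _ _ _ D I01 _ (measurable_itv _) D01).
Qed.

Lemma mean_itv01 : 0 <= mean <= 1.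
Proof.
rewrite meanE; apply/andP; split.
  by apply: Rintegral_ge0 => x; rewrite /I01/= in_itv => /andP[].
have -> : 1 = (\int[D]_(x in I01) 1)%R.
  by rewrite Rintegral_cst// ?DI01 ?mulr1//; exact: measurable_itv.
apply: le_Rintegral => //; [exact: measurable_itv|exact: (integrable_cst 1)|].
by move=> x; rewrite /I01/= in_itv => /andP[].
Qed.

(** A weak form of Hoeffding's lemma, with 2 in place of 1/8 and for small [s] only: integrate the
    quadratic bound on the exponential, use [x ^+ 2 <= 1], and conclude by [1 + z <= expR z]. *)
Lemma mgf_le (s : R) : `|s| <= 1 / 2 ->
  (\int[D]_x (expR (s * x))%:E <= (expR (s * mean + 2 * s ^+ 2))%:E)%E.
Proof.
move=> s2; have ms : measurable_fun setT (fun x => expR (s * x)).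
  by apply: measurableT_comp; [exact: measurable_expR|exact: measurable_funM].
have sx x : I01 x -> `|s * x| <= `|s|.
  rewrite /I01/= in_itv/= => /andP[x0 x1].
  by rewrite normrM (ger0_norm x0) ler_piMr.
have i1 : D.-integrable I01 (EFin \o (fun x => expR (s * x))).
  apply: integrable01 => //; exists (expR `|s|); split; first exact: num_real.
  move=> y sy x /= /sx ?; rewrite ger0_norm ?expR_ge0//.
  by rewrite (le_trans _ (ltW sy))// ler_expR (le_trans (ler_norm _)).
have i2 : D.-integrable I01 (EFin \o (fun x => s * x)).
  apply: integrable01; first exact: measurable_funM.
  exists `|s|; split => // y sy x /= /sx h; exact: le_trans (ltW sy).
rewrite (@integral_conull _ _ _ D I01 _ (measurable_itv _) D01)//; last exact/measurable_EFinP.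
have fin : (\int[D]_(x in I01) (expR (s * x))%:E)%E \is a fin_num.
  by apply: integrable_fin_num => //; exact: measurable_itv.
rewrite -(fineK fin) lee_fin.
have : (\int[D]_(x in I01) expR (s * x) <= \int[D]_(x in I01) (s * x + (1 + 2 * s ^+ 2)))%R.
  apply: le_Rintegral => //; first exact: measurable_itv.
  - exact: (@integrableD _ _ _ D I01 (measurable_itv _) _ _ i2 (integrable_cst (1 + 2 * s ^+ 2))).
  - move=> x xI; have := sx _ xI => h; have := expR_le_quad _ (le_trans h s2).
    move: xI; rewrite /I01/= in_itv/= => /andP[x0 x1].
    have : x ^+ 2 <= 1 by rewrite expr_le1.
    have : 0 <= s ^+ 2 by exact: sqr_ge0.
    by rewrite exprMn; nra.
move=> /le_trans; apply.
rewrite RintegralD//; [|exact: measurable_itv|exact: integrable_cst].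
rewrite RintegralZl//; last exact: measurable_itv.
rewrite -meanE Rintegral_cst; last exact: measurable_itv.
rewrite DI01 mulr1 (le_trans _ (expR_ge1Dx _))//; lra.
Qed.

End unit_interval.

(** * Chernoff bounds for sums of independent variables *)

Section tails.
Context {R : realType} {d : measure_display} {T : measurableType d}.
Context (P : probability T R) {I : eqType} (Y : I -> {RV P >-> R}).

Let measurable_sum (F : seq I) : measurable_fun setT (fun w => \sum_(a <- F) Y a w).
Proof.
elim: F => [|a F IH].
  by under eq_fun do rewrite big_nil; exact: measurable_cst.
by under eq_fun do rewrite big_cons; exact: measurable_funD.
Qed.

(** Markov's inequality for the exponential of [s] times the sum, whose expectation factorizes by
    independence. The sign of [s] is free, so both tails are covered. *)
Lemma markov_exp_sum (F : seq I) (s c t : R) :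
  mutually_independent P Y -> uniq F ->
  (forall a, a \in F -> (\int[P]_w (expR (s * Y a w))%:E <= (expR c)%:E)%E) ->
  (P [set w | (t <= s * \sum_(a <- F) Y a w)%R] <= (expR ((size F)%:R * c - t))%:E)%E.
Proof.
move=> ind uF hc.
have mA : measurable [set w | t <= s * \sum_(a <- F) Y a w].
  rewrite -[X in measurable X]setTI.
  have mf : measurable_fun setT (fun w => s * \sum_(a <- F) Y a w) by exact: measurable_funM.
  rewrite (_ : [set _ | _] = (fun w => s * \sum_(a <- F) Y a w) @^-1` `[t, +oo[%classic).
    exact: mf.
  by apply/seteqP; split => w /=; rewrite in_itv/= andbT.
have mE : measurable_fun setT (fun x : R => expR (s * x)).
  by apply: measurableT_comp; [exact: measurable_expR|exact: measurable_funM].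
have E0 a : (0 <= \int[P]_w (expR (s * Y a w))%:E)%E.
  by apply: integral_ge0 => w _; rewrite lee_fin expR_ge0.
have h : ((expR t)%:E * P [set w | (t <= s * \sum_(a <- F) Y a w)%R] <=
    \int[P]_w (\prod_(a <- F) expR (s * Y a w))%:E)%E.
  rewrite -[in leLHS](setIT [set w | _]) -integral_indic// -ge0_integralZl//; last first.
    by apply/measurable_EFinP; exact: measurable_indic.
  apply: ge0_le_integral => //.
  - by apply/measurable_EFinP; apply: measurable_funM => //; exact: measurable_indic.
  - apply/measurable_EFinP; under eq_fun do rewrite -expR_sum -mulr_sumr.
    by apply: measurableT_comp; [exact: measurable_expR|exact: measurable_funM].
  move=> w _; rewrite -EFinM lee_fin -expR_sum -mulr_sumr indicE.
  have [/set_mem/= wA|_] := boolP (w \in _); last by rewrite mulr0 expR_ge0.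
  by rewrite mulr1 ler_expR.
rewrite -(@lee_pmul2l _ (expR t)%:E)//; last by rewrite lte_fin expR_gt0.
apply: (le_trans h); rewrite -EFinM -expRD addrC subrK.
rewrite (expectation_prod_indep P _ Y (fun _ x => expR (s * x)))//; last first.
  by move=> a aF; rewrite ge0_fin_numE// (le_lt_trans (hc _ aF))// ltry.
elim: F hc {uF mA h} => [|a F IH] hc; first by rewrite big_nil mul0r expR0.
rewrite big_cons /= -nat1r mulrDl mul1r expRD EFinM lee_pmul//.
- by apply: prode_ge0 => b _.
- by rewrite hc// inE eqxx.
- by apply: IH => b bF; rewrite hc// inE bF orbT.
Qed.

Lemma mean_deviation (F : seq I) (m b : R) :
  mutually_independent P Y -> uniq F -> 0 < b <= 1 ->
  (forall a s, a \in F -> `|s| <= 1 / 2 ->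
    (\int[P]_w (expR (s * Y a w))%:E <= (expR (s * m + 2 * s ^+ 2))%:E)%E) ->
  (P [set w | ((size F)%:R * b < `|\sum_(a <- F) Y a w - (size F)%:R * m|)%R] <=
    (2 * expR (- ((size F)%:R * b ^+ 2 / 8)))%:E)%E.
Proof.
move=> ind uF /andP[b0 b1] hm; set N := (size F)%:R.
have mge (f : T -> R) t : measurable_fun setT f -> measurable [set w | t <= f w].
  move=> mf; rewrite -[X in measurable X]setTI.
  rewrite (_ : [set _ | _] = f @^-1` `[t, +oo[%classic); first exact: mf.
  by apply/seteqP; split => w /=; rewrite in_itv/= andbT.
have mgt (f : T -> R) t : measurable_fun setT f -> measurable [set w | t < f w].
  move=> mf; rewrite -[X in measurable X]setTI.
  rewrite (_ : [set _ | _] = f @^-1` `]t, +oo[%classic); first exact: mf.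
  by apply/seteqP; split => w /=; rewrite in_itv/= andbT.
pose U s t := [set w | t <= s * \sum_(a <- F) Y a w].
have mU s t : measurable (U s t) by apply: mge; exact: measurable_funM.
(* The exponent [N * (2 * s ^+ 2 - |s| * b)] is smallest at [|s| = b / 4], where it equals
   [- N * b ^+ 2 / 8]. *)
have tail s : `|s| = b / 4 ->
    (P (U s (N * (s * m + b ^+ 2 / 4))%R) <= (expR (- (N * b ^+ 2 / 8)))%:E)%E.
  move=> sE; have s2 : s ^+ 2 = b ^+ 2 / 16 by rewrite -real_normK ?num_real// sE; by field.
  apply: le_trans (markov_exp_sum _ s (s * m + 2 * s ^+ 2) _ ind uF _) _.
    by move=> a aF; apply: hm => //; rewrite sE; lra.
  rewrite lee_fin ler_expR s2 -/N le_eqVlt; apply/orP; left; apply/eqP; by field.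
have hb : `|b / 4| = b / 4 by rewrite ger0_norm//; lra.
set U1 := U (b / 4) (N * (b / 4 * m + b ^+ 2 / 4)).
set U2 := U (- (b / 4)) (N * (- (b / 4) * m + b ^+ 2 / 4)).
have sub : [set w | (N * b < `|\sum_(a <- F) Y a w - N * m|)%R] `<=` U1 `|` U2.
  move=> w /=; rewrite /U1 /U2 /U/=; set S := \sum_(a <- F) _.
  have [h|h] := ltrP 0 (S - N * m).
    by rewrite gtr0_norm// => ?; left; nra.
  by rewrite ler0_norm// => ?; right; nra.
have mV : measurable [set w | N * b < `|\sum_(a <- F) Y a w - N * m|].
  by apply: mgt; apply: measurableT_comp => //; exact: measurable_funB.
have le1 := le_measure P (mem_set mV) (mem_set (measurableU _ _ (mU _ _) (mU _ _))) sub.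
apply: (le_trans le1); apply: (le_trans (measureU2 _ _ _)) => //.
by rewrite mulr_natl mulr2n EFinD leeD// tail// ?normrN.
Qed.

End tails.

(** * Elimination *)

Section elimination.
Context {R : realType} {n : nat}.
Implicit Types (e theta : 'I_n -> R) (S A Q Top : {set 'I_n}) (b : R).

(** [k] is the number of places still open and [S] the set of undecided arms;
    [i] itself is counted in [accepted] but not in [rejected]. *)
Definition accepted b e k S : {set 'I_n} :=
  [set i in S | #|[set j in S | (e i - 2 * b <= e j)%R]| <= k]%N.

Definition rejected b e k S : {set 'I_n} :=
  [set i in S | k <= #|[set j in S | (e i + 2 * b < e j)%R]|]%N.

Definition update K b e (st : {set 'I_n} * {set 'I_n}) :=
  let acc := accepted b e (K - #|st.2|) st.1 in
  (st.1 :\: (acc :|: rejected b e (K - #|st.2|) st.1), st.2 :|: acc).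

(** A [k]-subset of [S] with the largest total estimate (empty if [S] has no
    [k]-subset). *)
Definition best e (k : nat) S : {set 'I_n} :=
  odflt finset.set0 [pick Q : {set 'I_n} | [&& Q \subset S, #|Q| == k &
    [forall Q' : {set 'I_n}, (Q' \subset S) && (#|Q'| == k) ==>
      (\sum_(i in Q') e i <= \sum_(i in Q) e i)]]].

Lemma bestP e k S Q0 : Q0 \subset S -> #|Q0| = k ->
  [/\ best e k S \subset S, #|best e k S| = k &
    \sum_(i in Q0) e i <= \sum_(i in best e k S) e i].
Proof.
move=> Q0S Q0k; rewrite /best; case: pickP => [Q /and3P[QS /eqP Qk /forallP h]|none] /=.
  by split => //; have := h Q0; rewrite Q0S Q0k eqxx.
pose ok Q := (Q \subset S) && (#|Q| == k).
have ok0 : ok Q0 by rewrite /ok Q0S Q0k eqxx.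
have [Q /andP[QS Qk] Qmax] :=
  @Order.TotalTheory.arg_maxP _ _ _ Q0 ok (fun Q => \sum_(i in Q) e i) ok0.
have := none Q; rewrite QS Qk /= => /negbT/forallPn[Q'].
by rewrite negb_imply => /andP[/Qmax h /negP[]].
Qed.

Variables (K : nat) (theta : 'I_n -> R) (Top : {set 'I_n}).
Hypothesis cardTop : #|Top| = K.
Hypothesis theta_Top : forall i j, i \in Top -> j \notin Top -> theta j <= theta i.

(** A state is the pair of the undecided and the accepted arms. *)
Definition consistent (st : {set 'I_n} * {set 'I_n}) :=
  [&& st.2 \subset Top, Top \subset st.1 :|: st.2 & st.2 \subset ~: st.1].

(** Consistency makes the accepted arms exactly the top arms outside [st.1], so the open places are
    those of the undecided top arms. *)
Lemma card_undecided_top st : consistent st -> #|Top :&: st.1| = (K - #|st.2|)%N.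
Proof.
case: st => S A /and3P[/= AT TSA dSA].
have <- : Top :\: S = A.
  apply/setP => i; rewrite !inE; have [iS|iS] /= := boolP (i \in S).
    by apply/esym/negbTE; apply: contraL iS => /(fintype.subsetP dSA); rewrite inE.
  apply/idP/idP => [/(fintype.subsetP TSA)|/(fintype.subsetP AT)//].
  by rewrite inE (negbTE iS).
by rewrite -cardTop -(cardsID S Top) addnK.
Qed.

Section round.
Variables (b : R) (e : 'I_n -> R) (st : {set 'I_n} * {set 'I_n}).
Hypothesis cst : consistent st.
Hypothesis good : forall i, i \in st.1 -> `|e i - theta i| <= b.

Let goodW i : i \in st.1 -> theta i - b <= e i /\ e i <= theta i + b.
Proof. by move=> /good; rewrite ler_norml => /andP[? ?]; split; lra. Qed.

(** For [i] outside [Top], each of the [k] undecided top arms has an estimate at least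
    [e i - 2 * b]. Together with [i] itself these are [k + 1] arms, too many for acceptance. *)
Lemma accepted_top : accepted b e (K - #|st.2|) st.1 \subset Top.
Proof.
apply/fintype.subsetP => i; rewrite inE => /andP[iS]; apply: contraTT => iT.
rewrite -ltnNge -(card_undecided_top _ cst) -add1n.
have -> : (1 + #|Top :&: st.1| = #|i |: (Top :&: st.1)|)%N.
  by rewrite cardsU1 !inE (negbTE iT).
apply/subset_leq_card/fintype.subsetP => j; rewrite !inE.
have [hi1 hi2] := goodW _ iS => /orP[/eqP->|/andP[jT jS]].
  by rewrite iS /=; have := good _ iS; have := normr_ge0 (e i - theta i); lra.
have [hj1 hj2] := goodW _ jS; have := theta_Top _ _ jT iT.
by rewrite jS /=; lra.
Qed.

(** An arm that surely beats [i] has a strictly larger mean. If [i] is in [Top], such arms are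
    undecided top arms other than [i], hence fewer than [k]. *)
Lemma rejected_top : rejected b e (K - #|st.2|) st.1 \subset ~: Top.
Proof.
apply/fintype.subsetP => i; rewrite !inE => /andP[iS].
apply: contraL => iT; rewrite -ltnNge -(card_undecided_top _ cst).
rewrite (cardsD1 i (Top :&: st.1)) !inE iT iS add1n ltnS.
apply/subset_leq_card/fintype.subsetP => j; rewrite !inE => /andP[jS ij].
have [hi1 hi2] := goodW _ iS; have [hj1 hj2] := goodW _ jS.
have lt_ij : theta i < theta j by lra.
rewrite jS andbT; apply/andP; split; first by apply: contraTneq lt_ij => ->; rewrite ltxx.
by apply: contraTT lt_ij => jT; rewrite -leNgt; exact: theta_Top.
Qed.

Lemma update_consistent : consistent (update K b e st).
Proof.
have accT := accepted_top; have rejT := rejected_top.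
move: cst => /and3P[AT TSA dSA]; apply/and3P; split => /=.
- by rewrite finset.subUset AT.
- apply/fintype.subsetP => i iT; have := fintype.subsetP TSA i iT.
  rewrite !finset.in_setU finset.in_setD finset.in_setU.
  have /negbTE-> : i \notin rejected b e (K - #|st.2|) st.1.
    by apply: contraL iT => /(fintype.subsetP rejT); rewrite inE.
  rewrite orbF => /orP[->|->].
    by rewrite andbT; case: (i \in accepted _ _ _ _); rewrite ?orbT.
  by rewrite orbT.
- apply/fintype.subsetP => i.
  rewrite finset.in_setU finset.in_setC finset.in_setD finset.in_setU => /orP[iA|->//].
  have := fintype.subsetP dSA _ iA; rewrite inE => /negbTE ->.
  by rewrite andbF.
Qed.

(** As [i] was not accepted, more than [k] arms could beat it, so one of them lies outside the [k]
    undecided top arms. Its estimate is at most [2 * b] below that of [i], and two estimation errors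
    add [2 * b]. *)
Lemma survivor_top i : i \in (update K b e st).1 -> i \in Top ->
  exists2 j, j \notin Top & theta i - theta j <= 4 * b.
Proof.
rewrite !inE negb_or => /andP[/andP[+ _] iS] iT; rewrite iS /= -ltnNge => lt.
have : ~~ ([set j in st.1 | (e i - 2 * b <= e j)%R] \subset Top :&: st.1).
  apply: contraTN lt => /subset_leq_card; rewrite (card_undecided_top _ cst).
  by rewrite -leqNgt.
move=> /subsetPn[j]; rewrite !inE => /andP[jS le_ij]; rewrite jS andbT => jT.
exists j => //; have [hi1 hi2] := goodW _ iS; have [hj1 hj2] := goodW _ jS; lra.
Qed.

(** Dually, fewer than [k] arms surely beat [i], so one of the [k] undecided top arms does not. *)
Lemma survivor_not_top i : i \in (update K b e st).1 -> i \notin Top ->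
  exists2 j, j \in Top & theta j - theta i <= 4 * b.
Proof.
rewrite !inE negb_or => /andP[/andP[_ +] iS] iT; rewrite iS /= -ltnNge => lt.
have : ~~ (Top :&: st.1 \subset [set j in st.1 | (e i + 2 * b < e j)%R]).
  apply: contraTN lt => /subset_leq_card; rewrite (card_undecided_top _ cst).
  by rewrite -leqNgt.
move=> /subsetPn[j]; rewrite !inE => /andP[jT jS]; rewrite jS /= -leNgt => le_ji.
exists j => //; have [hi1 hi2] := goodW _ iS; have [hj1 hj2] := goodW _ jS; lra.
Qed.

(** The accepted arms cancel. The undecided top arms compete for [best], so they do not win on
    estimates; passing between means and estimates costs [b] per arm on each side. *)
Lemma output_regret :
  let T := st.2 :|: best e (K - #|st.2|) st.1 in
  #|T| = K /\ \sum_(i in Top) theta i - \sum_(i in T) theta i <=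
    2 * b * (K - #|st.2|)%:R.
Proof.
have kE := card_undecided_top _ cst.
have [QS Qk Qmax] := @bestP e _ st.1 _ (finset.subsetIr Top st.1) kE.
move: cst => /and3P[AT TSA dSA] /=; set k := (K - _)%N in kE Qk Qmax *.
set Q := best e k st.1 in QS Qk Qmax *.
have dis (B : {set 'I_n}) : B \subset st.1 -> st.2 :&: B = finset.set0.
  move=> BS; apply/setP => i; rewrite !inE; apply/negbTE/negP => /andP[].
  by move=> /(fintype.subsetP dSA); rewrite inE => iS /(fintype.subsetP BS); rewrite (negbTE iS).
have TE : Top = st.2 :|: (Top :&: st.1).
  apply/setP => i; rewrite !inE; have := fintype.subsetP TSA i; have := fintype.subsetP AT i.
  rewrite inE; case: (i \in Top) => [_ /(_ isT)|h _].
    by rewrite orbC.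
  by rewrite orbF; case: (i \in st.2) h => // /(_ isT).
split.
  rewrite cardsU dis// cards0 subn0 Qk.
  by rewrite subnKC// -cardTop subset_leq_card.
have sumU (B : {set 'I_n}) : B \subset st.1 ->
    \sum_(i in st.2 :|: B) theta i = \sum_(i in st.2) theta i + \sum_(i in B) theta i.
  move=> BS; rewrite -bigU/=; last by rewrite -finset.setI_eq0 dis.
  by apply: eq_bigl => i; rewrite !inE.
rewrite {1}TE !sumU ?finset.subsetIr//.
have hT : \sum_(i in Top :&: st.1) theta i <= \sum_(i in Top :&: st.1) e i + k%:R * b.
  rewrite -kE mulr_natl -sumr_const -big_split/=; apply: ler_sum => i.
  by rewrite inE => /andP[_ /goodW[]]; lra.
have hQ : \sum_(i in Q) e i <= \sum_(i in Q) theta i + k%:R * b.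
  rewrite -Qk mulr_natl -sumr_const -big_split/=; apply: ler_sum => i iQ.
  by have [] := goodW _ (fintype.subsetP QS _ iQ).
lra.
Qed.

End round.
End elimination.

(** * The policy and its execution *)

Section policy.
Context {R : realType} {n : nat}.
Implicit Types (e : nat -> 'I_n -> R) (h : seq ('I_n * R)).

(** A history yields correct estimates only for arms that are still played, so a round must depend
    on undecided arms alone. *)
Lemma update_ext (K : nat) (b : R) (e e' : 'I_n -> R) (st : {set 'I_n} * {set 'I_n}) :
  (forall i, i \in st.1 -> e i = e' i) -> update K b e st = update K b e' st.
Proof.
move=> ee'.
have accE k : accepted b e k st.1 = accepted b e' k st.1.
  apply/setP => i; rewrite !inE; have [iS|//] := boolP (i \in st.1).
  congr (_ <= _)%N; apply: eq_card => j; rewrite !inE.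
  by have [jS|//] := boolP (j \in st.1); rewrite !ee'.
have rejE k : rejected b e k st.1 = rejected b e' k st.1.
  apply/setP => i; rewrite !inE; have [iS|//] := boolP (i \in st.1).
  congr (_ <= _)%N; apply: eq_card => j; rewrite !inE.
  by have [jS|//] := boolP (j \in st.1); rewrite !ee'.
by rewrite /update accE rejE.
Qed.

Lemma best_ext (e e' : 'I_n -> R) (k : nat) (S : {set 'I_n}) :
  (forall i, i \in S -> e i = e' i) -> best e k S = best e' k S.
Proof.
move=> ee'; have sE (Q : {set 'I_n}) : Q \subset S ->
    \sum_(i in Q) e i = \sum_(i in Q) e' i.
  by move=> /fintype.subsetP QS; apply: eq_bigr => i /QS /ee'.
rewrite /best; congr odflt; apply: eq_pick => Q /=.
have [QS|//] := boolP (Q \subset S); congr [&& _, _ & _].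
by apply/forallP/forallP => max Q'; have := max Q';
  have [Q'S|//] := boolP (Q' \subset S); rewrite !sE.
Qed.

Definition halfwidth (r : nat) : R := 2 ^- r.

Fixpoint rounds (K : nat) e (r : nat) : {set 'I_n} * {set 'I_n} :=
  if r is s.+1 then update K (halfwidth s) (e s) (rounds K e s)
  else ([set: 'I_n]%SET, finset.set0).

Lemma rounds_ext (K : nat) e e' (r : nat) :
  (forall s i, (s < r)%N -> i \in (rounds K e s).1 -> e s i = e' s i) ->
  rounds K e r = rounds K e' r.
Proof.
elim: r => //= r IH ee'; rewrite -IH; last by move=> s i sr; apply: ee'; exact: ltnW.
by apply: update_ext => i; apply: ee'.
Qed.

Definition settled (K : nat) (eps : R) e (r : nat) : bool :=
  2 * halfwidth r * (K - #|(rounds K e r).2|)%:R <= K%:R * eps.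

Definition verdict (K : nat) e (r : nat) : {set 'I_n} :=
  let st := rounds K e r in st.2 :|: best (e r) (K - #|st.2|) st.1.

(** [r] is the current round: the first one that still needs pulls or after
    which the policy stops. *)
Definition decide (fuel : nat) (N : nat -> nat) (K : nat) (eps : R) e
    (pulls : 'I_n -> nat) : action n :=
  let needs r i := (i \in (rounds K e r).1) && (pulls i < N r)%N in
  let r := find (fun r => [exists i, needs r i] || settled K eps e r) (iota 0 fuel) in
  if [pick i | needs r i] is Some i then Pull i else Stop (verdict K e r).

Definition pulls h (i : 'I_n) : nat := count (fun p => p.1 == i) h.

Definition rewards h (i : 'I_n) : seq R := [seq p.2 | p <- h & p.1 == i].

(** The policy replays all rounds from the history at every step. Truncating to the first [N r]
    rewards keeps the estimates of past rounds unchanged by later pulls. *)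
Definition estimate (N : nat -> nat) h (r : nat) (i : 'I_n) : R :=
  (\sum_(x <- take (N r) (rewards h i)) x) / (N r)%:R.

Definition table_estimate (N : nat -> nat) (X : 'I_n -> nat -> R) (r : nat) (i : 'I_n) : R :=
  (\sum_(j <- iota 0 (N r)) X i j) / (N r)%:R.

Definition policy (fuel : nat) (N : nat -> nat) (K : nat) (eps : R) h : action n :=
  decide fuel N K eps (estimate N h) (pulls h).

Lemma size_pulls h : size h = (\sum_i pulls h i)%N.
Proof.
elim: h => [|p h IH] /=; first by rewrite big1.
rewrite big_split/= -IH (bigD1 p.1)//= eqxx big1 ?addn0 ?add1n// => i.
by rewrite eq_sym => /negbTE ->.
Qed.

Section execution.
Variables (fuel : nat) (N : nat -> nat) (K : nat) (eps : R) (X : 'I_n -> nat -> R).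
Hypothesis fuel_enough : exists2 r, (r < fuel)%N & 2 * halfwidth r <= eps.
Let pol := policy fuel N K eps.
Let e := table_estimate N X.
Let reached r := forall s, (s < r)%N -> ~~ settled K eps e s.

Lemma rewards_run_hist k i :
  rewards (run_hist pol X k) i = map (X i) (iota 0 (pulls (run_hist pol X k) i)).
Proof.
elim: k => //= k IH; case: (pol _) => [a|//].
rewrite /rewards /pulls -cats1 filter_cat count_cat /= addn0 map_cat -/(rewards _ i) IH.
by have [->|ai] := eqVneq a i; rewrite /= ?cats0 ?addn0// iotaD map_cat.
Qed.

(** Before the current round no undecided arm lacks pulls, so the rounds replayed from the history
    coincide with those computed from the full reward table [X]. The run can then be analysed on the
    table, whatever the order of the pulls. *)
Lemma decision k :
  (exists r i, [/\ reached r, i \in (rounds K e r).1,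
     (pulls (run_hist pol X k) i < N r)%N & pol (run_hist pol X k) = Pull i]) \/
  (exists r, [/\ reached r, settled K eps e r &
     pol (run_hist pol X k) = Stop (verdict K e r)]).
Proof.
set h := run_hist pol X k.
have estE r i : (N r <= pulls h i)%N -> estimate N h r i = e r i.
  move=> le; rewrite /estimate /e /table_estimate rewards_run_hist -map_take take_iota.
  by rewrite (minn_idPl le) big_map.
pose needs r i := (i \in (rounds K (estimate N h) r).1) && (pulls h i < N r)%N.
pose ready r := [exists i, needs r i] || settled K eps (estimate N h) r.
pose r := find ready (iota 0 fuel).
have -> : pol h = if [pick i | needs r i] is Some i then Pull i
    else Stop (verdict K (estimate N h) r) by [].
(* The search succeeds: at accuracy [2 * halfwidth r0 <= eps] the round is settled whatever the
   number of open places, which is at most [K]. *)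
have r_fuel : (r < fuel)%N.
  have [r0 r0f r0e] := fuel_enough.
  rewrite -[X in (_ < X)%N](size_iota 0 fuel) -has_find; apply/hasP.
  exists r0; first by rewrite mem_iota.
  apply/orP; right; rewrite /settled (le_trans (ler_wpM2r _ r0e))// mulrC ler_wpM2r//.
    by rewrite (le_trans _ r0e)// mulr_ge0// /halfwidth invr_ge0 exprn_ge0.
  by rewrite ler_nat leq_subr.
have ready_r : ready r.
  have := nth_find 0 (a := ready) (s := iota 0 fuel).
  by rewrite has_find size_iota => /(_ r_fuel); rewrite nth_iota.
have before s : (s < r)%N -> ~~ ready s.
  move=> sr; have := before_find 0 sr; rewrite nth_iota ?add0n; first by move=> ->.
  exact: ltn_trans r_fuel.
have agree s i : (s < r)%N -> i \in (rounds K (estimate N h) s).1 -> estimate N h s i = e s i.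
  move=> /before; rewrite negb_or => /andP[/existsPn/(_ i)] + _ iS.
  by rewrite /needs iS /= -leqNgt => /estE.
have roundsE s : (s <= r)%N -> rounds K (estimate N h) s = rounds K e s.
  by move=> sr; apply: rounds_ext => s' i s's; apply: agree; exact: leq_trans sr.
have reach : reached r.
  move=> s sr; have := before _ sr; rewrite negb_or => /andP[_].
  by rewrite /settled roundsE// ltnW.
case: pickP => [i /andP[iS lt]|none].
  by left; exists r, i; split => //; rewrite -roundsE.
right; exists r; move: ready_r; rewrite /ready => /orP[/existsP[i]|].
  by rewrite none.
rewrite /settled /verdict roundsE// => sr; split => //; congr (Stop (_ :|: _)).
apply: best_ext => i iS; apply: estE; have := none i.
by rewrite /needs roundsE// iS /= => /negbT; rewrite -leqNgt.
Qed.

(** An arm is pulled only while its count is below some [N r <= M i], so no count exceeds [M i]. A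
    run that never stops would lengthen its history at each step, past the sum of the [M i]. *)
Lemma run_terminates (M : 'I_n -> nat) :
  (forall r i, reached r -> i \in (rounds K e r).1 -> (N r <= M i)%N) ->
  exists k r, [/\ reached r, settled K eps e r,
    pol (run_hist pol X k) = Stop (verdict K e r) &
    (size (run_hist pol X k) <= \sum_i M i)%N].
Proof.
move=> NM.
have le_M k i : (pulls (run_hist pol X k) i <= M i)%N.
  elim: k => //= k IH; case: (decision k) => [[r [a [rr aS lt ->]]]|[r [_ _ ->//]]].
  rewrite /pulls -cats1 count_cat /= addn0 -/(pulls _ _).
  have [<-|] := eqVneq a i; last by rewrite addn0.
  by rewrite addn1 (leq_trans lt)// NM.
have size_le k : (size (run_hist pol X k) <= \sum_i M i)%N.
  by rewrite size_pulls; apply: leq_sum.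
have [[k [r [rr sr stop]]]|run] := pselect (exists k r, [/\ reached r, settled K eps e r &
    pol (run_hist pol X k) = Stop (verdict K e r)]).
  by exists k, r; split.
have sizeE k : size (run_hist pol X k) = k.
  elim: k => //= k IH; case: (decision k) => [[r [a [_ _ _ ->]]]|[r hr]].
    by rewrite size_rcons IH.
  by exfalso; apply: run; exists k, r.
by have := size_le (\sum_i M i).+1; rewrite sizeE ltnn.
Qed.

End execution.
End policy.

(** * Gaps and the rounds played *)

Section sorted_means.
Context {R : realType} {n : nat}.
Variable theta : 'I_n -> R.

(** [sorted_mean] lists values without their arms. This sort of the arms themselves fixes one order,
    ties included, through which ranks and top arms are defined. *)
Definition ranking : seq 'I_n :=
  sort (relpre theta (fun x y : R => y <= x)) (enum 'I_n).

Definition rank (i : 'I_n) : nat := (index i ranking).+1.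

Lemma perm_ranking : perm_eq ranking (enum 'I_n).
Proof. by rewrite perm_sort. Qed.

Lemma size_ranking : size ranking = n.
Proof. by rewrite (perm_size perm_ranking) size_enum_ord. Qed.

Lemma uniq_ranking : uniq ranking.
Proof. by rewrite (perm_uniq perm_ranking) enum_uniq. Qed.

Lemma mem_ranking i : i \in ranking.
Proof. by rewrite (perm_mem perm_ranking) mem_enum. Qed.

Lemma rank_le i : (rank i <= n)%N.
Proof. by rewrite /rank -{2}size_ranking index_mem mem_ranking. Qed.

Lemma sorted_meanE k : sorted_mean theta k = nth 0 (map theta ranking) k.-1.
Proof. by rewrite /sorted_mean sort_map. Qed.

Lemma sorted_mean_rank i : sorted_mean theta (rank i) = theta i.
Proof.
by rewrite sorted_meanE /= (nth_map i) ?index_mem ?mem_ranking// nth_index ?mem_ranking.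
Qed.

Lemma sorted_mean_le k l : (0 < k)%N -> (k <= l <= n)%N ->
  sorted_mean theta l <= sorted_mean theta k.
Proof.
case: k => // k _; case: l => // l /andP[kl ln]; rewrite !sorted_meanE /=.
apply: (@sorted_leq_nth _ (fun x y : R => y <= x)) => //.
- by move=> y x z xy yz; exact: le_trans yz xy.
- by rewrite -sort_map sort_sorted// => x y; exact: le_total.
- by rewrite inE size_map size_ranking; exact: leq_trans ln.
- by rewrite inE size_map size_ranking.
Qed.

Definition top_arms (K : nat) : {set 'I_n} := [set i in take K ranking].

Lemma in_top_arms K i : (i \in top_arms K) = (rank i <= K)%N.
Proof. by rewrite inE in_take// mem_ranking. Qed.

Lemma card_top_arms K : (K <= n)%N -> #|top_arms K| = K.
Proof.
move=> Kn; rewrite cardsE (card_uniqP _) ?take_uniq ?uniq_ranking//.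
by rewrite size_takel// size_ranking.
Qed.

(** Translates sums over positions into sums over arms: at [K] for the regret, and at [n] for the
    total cost. *)
Lemma sum_top_arms K (F : nat -> R) : (K <= n)%N ->
  \sum_(1 <= k < K.+1) F k = \sum_(i in top_arms K) F (rank i).
Proof.
move=> Kn; rewrite big_add1 /=.
transitivity (\sum_(i <- take K ranking) F (rank i)); last first.
  rewrite big_uniq ?take_uniq ?uniq_ranking//.
  by apply: eq_bigl => i; rewrite inE.
case: (posnP n) => [n0|n0].
  have K0 : K = 0%N by apply/eqP; rewrite -leqn0 -n0.
  by rewrite K0 take0 !big_nil.
rewrite (big_nth (Ordinal n0)) size_takel ?size_ranking//.
rewrite big_nat [RHS]big_nat; apply: eq_bigr => k /andP[_ kK].
by rewrite nth_take// /rank index_uniq ?uniq_ranking// size_ranking (leq_trans kK).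
Qed.

(** The value [t = 0] always qualifies, so the maximum ranges over a nonempty set and is
    attained. *)
Lemma t_paramP K eps : (0 < K)%N -> 0 <= eps ->
  let t := t_param K eps theta in
  (t < K)%N /\ gap K theta (K - t) * t%:R <= K%:R * eps.
Proof.
move=> K0 eps0; rewrite /t_param.
set A := [pred t : 'I_K | gap K theta (K - t) * t%:R <= K%:R * eps].
have A0 : (0 < #|A|)%N.
  by apply/card_gt0P; exists (Ordinal K0); rewrite inE/= mulr0 mulr_ge0.
have [t tA tE] := @eq_bigmax_cond _ A (fun t : 'I_K => t : nat) A0.
rewrite (_ : \max_(_ < _ | _) _ = \max_(i in A) i)%N; last exact: eq_bigl.
by rewrite tE; split.
Qed.

End sorted_means.

Section analysis.
Context {R : realType} {n : nat}.
Variables (K : nat) (eps : R) (theta : 'I_n -> R).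
Hypotheses (K_gt0 : (0 < K)%N) (K_ltn : (K < n)%N) (eps_gt0 : 0 < eps) (eps_le1 : eps <= 1).
Hypothesis theta01 : forall i, 0 <= theta i <= 1.

Let Top := top_arms theta K.
Let gapi i := gap K theta (rank theta i).
Let D := Delta_eps K eps theta.

Let cardTop : #|Top| = K. Proof. exact/card_top_arms/ltnW. Qed.

Let not_top_le i : i \notin Top -> theta i <= sorted_mean theta K.+1.
Proof.
rewrite in_top_arms -ltnNge => Ki; rewrite -sorted_mean_rank.
by apply: sorted_mean_le; rewrite // Ki rank_le.
Qed.

Let top_ge i : i \in Top -> sorted_mean theta K <= theta i.
Proof.
rewrite in_top_arms => iK; rewrite -[theta i]sorted_mean_rank.
by apply: sorted_mean_le; rewrite // iK ltnW.
Qed.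

Let theta_Top i j : i \in Top -> j \notin Top -> theta j <= theta i.
Proof.
move=> /top_ge iT /not_top_le jT; apply: le_trans jT (le_trans _ iT).
by apply: sorted_mean_le; rewrite // leqnSn.
Qed.

Let sorted_mean01 k : (0 < k <= n)%N -> 0 <= sorted_mean theta k <= 1.
Proof.
case: k => // k /= kn; rewrite sorted_meanE /=.
have i : 'I_n by exact: Ordinal (leq_ltn_trans (leq0n k) kn).
by rewrite (nth_map i)// size_ranking.
Qed.

Lemma gap_itv01 k : (0 < k <= n)%N -> 0 <= gap K theta k <= 1.
Proof.
move=> /andP[k0 kn]; rewrite /gap.
have /andP[? ?] : 0 <= sorted_mean theta k <= 1 by rewrite sorted_mean01// k0.
have /andP[? ?] : 0 <= sorted_mean theta K <= 1 by rewrite sorted_mean01// K_gt0 ltnW.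
have /andP[? ?] : 0 <= sorted_mean theta K.+1 <= 1 by rewrite sorted_mean01.
case: leqP => kK.
  have : sorted_mean theta K.+1 <= sorted_mean theta k.
    by apply: sorted_mean_le; rewrite // (leq_trans kK).
  by move=> ?; apply/andP; split; lra.
have : sorted_mean theta k <= sorted_mean theta K.
  by apply: sorted_mean_le; rewrite // ltnW.
by move=> ?; apply/andP; split; lra.
Qed.

Let gapi01 i : 0 <= gapi i <= 1.
Proof. by apply: gap_itv01; rewrite rank_le. Qed.

Lemma Delta_eps_bounds : eps <= D <= 1.
Proof.
rewrite /D /Delta_eps le_max lexx ge_max eps_le1 /=.
have [tK _] := t_paramP theta K eps K_gt0 (ltW eps_gt0).
suff /gap_itv01/andP[//] : (0 < K - t_param K eps theta <= n)%N.
by rewrite subn_gt0 tK (leq_trans (leq_subr _ _))// ltnW.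
Qed.

Variables (fuel : nat) (e : nat -> 'I_n -> R).
Hypothesis fuel_enough : exists2 r, (r < fuel)%N & 2 * halfwidth r <= eps.
Hypothesis good : forall r i, (r < fuel)%N -> `|e r i - theta i| <= halfwidth r.

Let reached r := forall s, (s < r)%N -> ~~ settled K eps e s.

(** The estimates are controlled only below [fuel]; a round where [2 * halfwidth] is at most [eps]
    is always settled, so none beyond it is reached. *)
Let reached_fuel r : reached r -> (r < fuel)%N.
Proof.
have [r0 r0f r0e] := fuel_enough; move=> rr; apply: leq_ltn_trans r0f.
rewrite leqNgt; apply/negP => /rr; apply/negP; rewrite negbK.
rewrite /settled (le_trans (ler_wpM2r _ r0e))// mulrC ler_wpM2r//; first exact: ltW.
by rewrite ler_nat leq_subr.
Qed.

Let consistent_rounds r : (r <= fuel)%N -> consistent Top (rounds K e r).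
Proof.
elim: r => [_|r IH rf] /=.
  by rewrite /consistent /= finset.sub0set finset.setU0 finset.subsetT finset.sub0set.
by apply: (update_consistent _ _ _ cardTop theta_Top _ _ _ (IH (ltnW rf))) => i _; exact: good.
Qed.

(** The arm [j] found on the other side of the boundary is no better than the [K.+1]-th mean, or no
    worse than the [K]-th, so the gap of [i] is at most its distance to [j]. *)
Let survivor_gap r i : (r < fuel)%N -> i \in (rounds K e r.+1).1 -> gapi i <= 4 * halfwidth r.
Proof.
move=> rf iS; have c := consistent_rounds _ (ltnW rf).
have g j : j \in (rounds K e r).1 -> `|e r j - theta j| <= halfwidth r by move=> _; exact: good.
have [iT|iT] := boolP (i \in Top).
  have [j jT h] := survivor_top _ _ _ cardTop _ _ _ c g _ iS iT.
  have := not_top_le _ jT; move: (iT); rewrite in_top_arms /gapi /gap => ->.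
  rewrite sorted_mean_rank; lra.
have [j jT h] := survivor_not_top _ _ _ cardTop _ _ _ c g _ iS iT.
have := top_ge _ jT; move: (iT); rewrite in_top_arms /gapi /gap => /negbTE->.
rewrite sorted_mean_rank; lra.
Qed.

Let halfwidth_gt0 r : 0 < halfwidth r :> R.
Proof. by rewrite /halfwidth invr_gt0 exprn_gt0. Qed.

Let halfwidthS r : halfwidth r = 2 * halfwidth r.+1 :> R.
Proof. by rewrite /halfwidth exprS invfM mulrA divff// mul1r. Qed.

Let reached_gap r i : reached r -> i \in (rounds K e r).1 -> gapi i <= 8 * halfwidth r.
Proof.
case: r => [_ _|r rr iS].
  by have /andP[_ h] := gapi01 i; rewrite /halfwidth expr0 invr1; lra.
have rf := ltnW (reached_fuel _ rr).
by have := survivor_gap _ _ rf iS; rewrite halfwidthS; lra.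
Qed.

(** Rounds 0 and 1 follow from [D <= 1]. If round [r.+2] were reached with [D] above
    [16 * halfwidth r.+2], which is [4 * halfwidth r], the arms surviving round [r] would have gaps
    below [D], and round [r.+1] would already be settled. *)
Lemma reached_Delta r : reached r -> D <= 16 * halfwidth r.
Proof.
have /andP[_ D1] := Delta_eps_bounds.
case: r => [_|[_|r rr]].
- by rewrite /halfwidth expr0 invr1; lra.
- by rewrite /halfwidth expr1; lra.
rewrite leNgt; apply/negP => Dlt.
have rf : (r.+1 < fuel)%N by exact: ltnW (reached_fuel _ rr).
have radE := halfwidthS r; have radE' := halfwidthS r.+1.
have rad0 := halfwidth_gt0 r.
have /negP[] := rr r.+1 (leqnn _); rewrite /settled.
rewrite -(card_undecided_top _ _ cardTop _ (consistent_rounds _ (ltnW rf))).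
set k := #|_|; rewrite -radE.
have kK : (k <= K)%N by rewrite -cardTop subset_leq_card// finset.subsetIl.
(* If [D] is [eps], even [K] open places are cheap enough; otherwise [D] is a gap and the definition
   of [t] enters. *)
have [Dle|epslt] := leP D eps.
  have : halfwidth r * k%:R <= eps * K%:R :> R by apply: ler_pM; rewrite ?ler_nat//; lra.
  by rewrite mulrC [eps * _]mulrC.
have [tK ht] := t_paramP theta K eps K_gt0 (ltW eps_gt0).
set t := t_param K eps theta in tK ht.
have DE : D = gap K theta (K - t).
  by move: epslt; rewrite /D /Delta_eps /Num.max; case: ifP => //; rewrite ltxx.
(* The open places belong to top arms of gap below [gap K theta (K - t)]. *)
have kt : (k <= t)%N.
  rewrite -(subKn (ltnW tK)) -[X in (_ <= X - _)%N]cardTop.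
  rewrite -(card_top_arms theta (K - t)); last by rewrite (leq_trans (leq_subr _ _))// ltnW.
  rewrite -cardsDS; last first.
    by apply/fintype.subsetP => i; rewrite !in_top_arms => /leq_trans; apply; exact: leq_subr.
  apply/subset_leq_card/fintype.subsetP => i; rewrite finset.in_setI => /andP[iT iS].
  rewrite finset.in_setD iT andbT in_top_arms -ltnNge ltnNge; apply/negP => irank.
  have := survivor_gap _ _ (ltnW rf) iS.
  have : sorted_mean theta (K - t) <= theta i.
    rewrite -[theta i]sorted_mean_rank; apply: sorted_mean_le => //.
    by rewrite irank (leq_trans (leq_subr _ _))// ltnW.
  move: DE iT; rewrite in_top_arms /gapi /gap leq_subr sorted_mean_rank => DE ->.
  lra.
have h : halfwidth r * k%:R <= D * t%:R by apply: ler_pM; rewrite ?ler_nat//; lra.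
by rewrite (le_trans h)// DE.
Qed.

Let cost i := cost_term K eps theta (rank theta i).

(** Both the gap of [i] and [D] are at most [16 * halfwidth r], whose inverse square is
    [4 ^+ r / 256]. A zero gap leaves only the term in [D]. *)
Lemma reached_cost r i : reached r -> i \in (rounds K e r).1 ->
  4 ^+ r / 256 <= cost i.
Proof.
move=> rr iS; have gr := reached_gap _ _ rr iS; have Dr := reached_Delta _ rr.
have /andP[epsD _] := Delta_eps_bounds; have rad0 := halfwidth_gt0 r.
have D0 : 0 < D by exact: lt_le_trans epsD.
have /andP[g0 _] := gapi01 i.
have E : 4 ^+ r / 256 = (16 * halfwidth r) ^- 2 :> R.
  have -> : 4 ^+ r = (2 ^+ r) ^+ 2 :> R by rewrite -exprM mulnC exprM; congr (_ ^+ _); ring.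
  rewrite /halfwidth; have : 2 ^+ r != 0 :> R by rewrite expf_neq0.
  by move: (2 ^+ r) => x x0; field.
have inv2 x : 0 < x -> x <= 16 * halfwidth r -> 4 ^+ r / 256 <= x ^- 2 :> R.
  by move=> x0 xr; rewrite [leLHS]E lef_pV2 ?posrE ?exprn_gt0 ?mulr_gt0//
    lerXn2r ?nnegrE// ltW// mulr_gt0.
rewrite /cost /cost_term -/D -/(gapi i); case: eqVneq => [_|gn0]; first exact: inv2.
by rewrite le_min !inv2// ?lt_neqAle 1?eq_sym ?gn0//; lra.
Qed.

Lemma reached_verdict r : reached r -> settled K eps e r ->
  eps_topK K eps theta (verdict K e r).
Proof.
move=> rr; rewrite /settled => sr; have rf := reached_fuel _ rr.
have g j : j \in (rounds K e r).1 -> `|e r j - theta j| <= halfwidth r by move=> _; exact: good.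
have [cT reg] := output_regret _ _ _ cardTop _ _ _ (consistent_rounds _ (ltnW rf)) g.
split => //; rewrite /agg_regret ler_pdivrMl ?ltr0n//.
rewrite (sum_top_arms theta _ (sorted_mean theta) (ltnW K_ltn)).
under eq_bigr do rewrite sorted_mean_rank.
exact: le_trans reg sr.
Qed.

End analysis.

(** * Sample sizes and the good event *)

Section constants.
Context {R : realType}.

(** The factor 2 is for the two tails and [n] for the arms; the inverse of [r.+1 * r.+2] telescopes
    when summed over the rounds. *)
Definition confidence (n : nat) (delta : R) (r : nat) : R :=
  ln (2 * n%:R * (r.+1%:R * r.+2%:R) / delta).

(** The factor [8 * 4 ^+ r] cancels [halfwidth r ^+ 2 / 8] in the deviation bound, leaving
    [confidence] as the exponent. The successor rounds up and keeps the quota positive. *)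
Definition quota (n : nat) (delta : R) (r : nat) : nat :=
  (Num.truncn (8 * 4 ^+ r * confidence n delta r)).+1.

(** A crude bound based on [r < 2 ^ r]. It only limits the search for the current round and does not
    enter the sample bound. *)
Definition horizon (eps : R) : nat := (Num.truncn (2 / eps)).+2.

Lemma ln2_ge : 1 / 2 <= ln 2 :> R.
Proof.
rewrite -ler_expR lnK ?posrE//.
have h : 1 / 2 <= expR (- (1 / 2)) :> R.
  by apply: le_trans (expR_ge1Dx _); lra.
by rewrite -[1 / 2]opprK expRN -[leRHS]invrK lef_pV2 ?posrE ?expR_gt0//; lra.
Qed.

Lemma horizon_enough (eps : R) : 0 < eps ->
  exists2 r, (r < horizon eps)%N & 2 * halfwidth r <= eps.
Proof.
move=> eps0; exists (Num.truncn (2 / eps)).+1 => //.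
have := truncnS_gt (2 / eps); move: (Num.truncn _).+1 => r rlt.
have : 2 / eps <= 2 ^+ r.
  by rewrite (le_trans (ltW rlt))// -natrX ler_nat; exact/ltnW/ltn_expl.
by rewrite /halfwidth ler_pdivrMr// mulrC ler_pdivrMr ?exprn_gt0.
Qed.

Section fixed.
Variables (n : nat) (delta : R).
Hypotheses (n_ge2 : (2 <= n)%N) (delta_gt0 : 0 < delta) (delta_le : delta <= 1 / 2).

Lemma confidenceE r : confidence n delta r =
  ln 2 + ln n%:R + (ln r.+1%:R + ln r.+2%:R) + ln delta^-1.
Proof.
have n0 : 0 < n%:R :> R by rewrite ltr0n ltnW.
by rewrite /confidence !lnM ?posrE ?mulr_gt0 ?invr_gt0.
Qed.

Lemma ln2_le_ln_nat : ln 2 <= ln n%:R :> R.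
Proof.
have n0 : 0 < n%:R :> R by rewrite ltr0n ltnW.
by rewrite ler_ln ?posrE// ler_nat.
Qed.

Lemma ln2_le_ln_inv : ln 2 <= ln delta^-1.
Proof.
by rewrite ler_ln ?posrE ?invr_gt0// -[delta^-1]mul1r ler_pdivlMr// mulrC -ler_pdivlMr.
Qed.

Lemma confidence_ge1 r : 1 <= confidence n delta r.
Proof.
have h := ln2_ge; have h1 := ln2_le_ln_nat; have h2 := ln2_le_ln_inv.
rewrite confidenceE.
have : 0 <= ln r.+1%:R :> R by rewrite ln_ge0// ler1n.
have : 0 <= ln r.+2%:R :> R by rewrite ln_ge0// ler1n.
by lra.
Qed.

(** Source of the iterated logarithm: [2 ^+ r <= 16 / D] makes [r] of order [ln (4 / D)], and
    [confidence] depends on [r] only through [ln r.+1] and [ln r.+2]. The multiples of [ln 2] are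
    absorbed by [ln n] and [ln delta^-1]. *)
Lemma confidence_le (D : R) r : 0 < D <= 1 -> D <= 16 * halfwidth r ->
  confidence n delta r <= 8 * (ln (ln (4 / D)) + ln n%:R + ln delta^-1).
Proof.
move=> /andP[D0 D1] Dr; have h2 := ln2_ge.
have D4 : 4 <= 4 / D by rewrite ler_pdivlMr//; lra.
set x := ln (4 / D).
have x1 : 1 <= x.
  apply: (@le_trans _ _ (ln 4)); last by rewrite ler_ln ?posrE ?(lt_le_trans _ D4).
  by rewrite (_ : 4 = 2 * 2) ?lnM ?posrE//; [lra|ring].
(* Since [D <= 1], [16 / D] is at most [(4 / D) ^+ 2]. *)
have rx : r%:R * ln 2 <= 2 * x.
  rewrite mulr_natl -lnXn// /x mulr_natl -lnXn ?(lt_le_trans _ D4)//.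
  rewrite ler_ln ?posrE ?exprn_gt0 ?(lt_le_trans _ D4)//.
  apply: (@le_trans _ _ (16 / D)).
    move: Dr; rewrite /halfwidth ler_pdivlMr// mulrC.
    by rewrite ler_pdivlMr ?exprn_gt0.
  rewrite (_ : 16 / D = 16 * D * D ^- 2); last by field; rewrite gt_eqF.
  rewrite (_ : (4 / D) ^+ 2 = 16 * D ^- 2); last by field; rewrite gt_eqF.
  by rewrite ler_wpM2r ?invr_ge0 ?exprn_ge0 ?(ltW D0)//; lra.
have r0 : 0 <= r%:R :> R by [].
have r8 : r.+2%:R <= 8 * x.
  by rewrite -addn2 natrD; nra.
have lnr2 : ln r.+2%:R <= 3 * ln 2 + ln x.
  apply: (@le_trans _ _ (ln (8 * x))).
    by rewrite ler_ln ?posrE// mulr_gt0//; lra.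
  rewrite (_ : 8 = 2 ^+ 3); last by ring.
  by rewrite lnM ?posrE ?exprn_gt0//; [rewrite lnXn// mulr_natl|lra].
have lnr1 : ln r.+1%:R <= ln r.+2%:R :> R by rewrite ler_ln ?posrE// ler_nat.
have lnx : 0 <= ln x by rewrite ln_ge0.
by rewrite confidenceE; have := ln2_le_ln_nat; have := ln2_le_ln_inv; lra.
Qed.

Lemma quota_ge r : 8 * 4 ^+ r * confidence n delta r <= (quota n delta r)%:R.
Proof. exact/ltW/truncnS_gt. Qed.

Lemma quota_le r : (quota n delta r)%:R <= 9 * 4 ^+ r * confidence n delta r.
Proof.
have c1 := confidence_ge1 r.
have p1 : 1 <= 4 ^+ r :> R by rewrite exprn_ege1//; lra.
have pc : 1 <= 4 ^+ r * confidence n delta r by rewrite -[leLHS]mulr1 ler_pM.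
rewrite /quota -addn1 natrD; set y := 8 * _ * _.
have : (Num.truncn y)%:R <= y by rewrite truncn_le// /y -mulrA; lra.
by rewrite /y -!mulrA; lra.
Qed.

Lemma quota_tail r :
  2 * expR (- ((quota n delta r)%:R * halfwidth r ^+ 2 / 8)) <=
  delta / n%:R * (r.+1%:R^-1 - r.+2%:R^-1).
Proof.
have hE : halfwidth r ^+ 2 = (4 ^+ r)^-1 :> R.
  by rewrite /halfwidth exprVn -exprM mulnC exprM; congr (_ ^+ _)^-1; ring.
have p0 : 0 < 4 ^+ r :> R by rewrite exprn_gt0.
have n0 : 0 < n%:R :> R by rewrite ltr0n ltnW.
have : expR (- ((quota n delta r)%:R * halfwidth r ^+ 2 / 8)) <=
    expR (- confidence n delta r).
  rewrite ler_expR lerN2 hE ler_pdivlMr// ler_pdivlMr//.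
  by apply: le_trans (quota_ge r); rewrite le_eqVlt; apply/orP; left; apply/eqP; ring.
have -> : expR (- confidence n delta r) = delta / (2 * n%:R * (r.+1%:R * r.+2%:R)).
  by rewrite expRN /confidence lnK ?invf_div// posrE divr_gt0 ?mulr_gt0.
move=> h; apply: (le_trans (ler_wpM2l _ h)) => //.
rewrite -natr1 -[r.+1%:R]natr1 le_eqVlt; apply/orP; left; apply/eqP.
have r0 : 0 <= r%:R :> R by [].
by field; rewrite !gt_eqF//=; lra.
Qed.

End fixed.
End constants.

Lemma union_bound {R : realType} {d : measure_display} {T : measurableType d}
    (P : probability T R) (I : eqType) (s : seq I) (F : I -> set T) (b : I -> R) :
  (forall i, i \in s -> measurable (F i)) ->
  (forall i, i \in s -> (P (F i) <= (b i)%:E)%E) ->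
  measurable [set w | exists2 i, i \in s & F i w] /\
  (P [set w | exists2 i, i \in s & F i w] <= (\sum_(i <- s) b i)%:E)%E.
Proof.
elim: s => [|a s IH] mF PF.
  rewrite (_ : [set w | _] = set0); last by apply/seteqP; split => // w [].
  by split => //; rewrite measure0 big_nil.
have [||mB PB] := IH.
- by move=> i si; apply: mF; rewrite inE si orbT.
- by move=> i si; apply: PF; rewrite inE si orbT.
have ma : measurable (F a) by apply: mF; rewrite inE eqxx.
have -> : [set w | exists2 i, i \in a :: s & F i w] =
    F a `|` [set w | exists2 i, i \in s & F i w].
  apply/seteqP; split => w /= => [[i]|[Fa|[i si Fi]]].
  - by rewrite inE => /predU1P[->|si]; [left|right; exists i].
  - by exists a => //; rewrite inE eqxx.
  - by exists i => //; rewrite inE si orbT.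
split; first exact: measurableU.
apply: (le_trans (measureU2 _ _ _)) => //; rewrite big_cons EFinD leeD//.
by apply: PF; rewrite inE eqxx.
Qed.

Section good_event.
Context {R : realType} {n : nat}.
Variables (delta : R) (fuel : nat) (D : 'I_n -> probability R R).
Hypotheses (n_ge2 : (2 <= n)%N) (delta_gt0 : 0 < delta).
Hypothesis D01 : forall i, D i `[0%R, 1%R]%classic = 1%E.
Context {d : measure_display} {Omega : measurableType d} (P : probability Omega R).
Variables (X : 'I_n -> nat -> {RV P >-> R}) (U : {RV P >-> R}).
Hypothesis lawX : forall i j B, measurable B -> P (X i j @^-1` B) = D i B.
Let table (a : option ('I_n * nat)) : {RV P >-> R} :=
  match a with None => U | Some ij => X ij.1 ij.2 end.
Hypothesis indep : mutually_independent P table.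
Let theta i := fine (\int[D i]_x (x%:E))%E.
Let N := quota n delta.

Lemma mgf_arm i j (s : R) : `|s| <= 1 / 2 ->
  (\int[P]_w (expR (s * X i j w))%:E <= (expR (s * theta i + 2 * s ^+ 2))%:E)%E.
Proof.
move=> s2; apply: le_trans (mgf_le _ (D01 i) _ s2).
have mf : measurable_fun setT (fun x : R => (expR (s * x))%:E).
  apply/measurable_EFinP; apply: measurableT_comp; first exact: measurable_expR.
  exact: measurable_funM.
rewrite -(ge0_integral_distribution (X i j) mf); last first.
  by move=> y; rewrite lee_fin expR_ge0.
rewrite (eq_measure_integral (D i))// => A mA _; exact: lawX.
Qed.

Definition deviates (p : nat * 'I_n) : set Omega :=
  [set w | (N p.1)%:R * halfwidth p.1 <
    `|\sum_(j <- iota 0 (N p.1)) X p.2 j w - (N p.1)%:R * theta p.2|].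

Let arm_sample (p : nat * 'I_n) : seq (option ('I_n * nat)) :=
  [seq Some (p.2, j) | j <- iota 0 (N p.1)].

Let sum_arm_sample p w :
  \sum_(a <- arm_sample p) table a w = \sum_(j <- iota 0 (N p.1)) X p.2 j w.
Proof. by rewrite big_map. Qed.

Lemma measurable_deviates p : measurable (deviates p).
Proof.
have ms (s : seq nat) : measurable_fun setT (fun w => \sum_(j <- s) X p.2 j w).
  elim: s => [|a s IH]; first by under eq_fun do rewrite big_nil; exact: measurable_cst.
  by under eq_fun do rewrite big_cons; exact: measurable_funD.
rewrite -[X in measurable X]setTI.
rewrite (_ : deviates p = (fun w =>
    `|\sum_(j <- iota 0 (N p.1)) X p.2 j w - (N p.1)%:R * theta p.2|) @^-1`
    `](N p.1)%:R * halfwidth p.1, +oo[%classic).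
  have : measurable_fun setT (fun w =>
    `|\sum_(j <- iota 0 (N p.1)) X p.2 j w - (N p.1)%:R * theta p.2|).
    by apply: measurableT_comp => //; exact: measurable_funB.
  by apply.
by apply/seteqP; split => w; rewrite /deviates/= in_itv/= andbT.
Qed.

Lemma deviates_le p : (P (deviates p) <=
  (delta / n%:R * (p.1.+1%:R^-1 - p.1.+2%:R^-1))%:E)%E.
Proof.
case: p => r i.
have h01 : 0 < (halfwidth r : R) <= 1.
  by rewrite /halfwidth invr_gt0 exprn_gt0//= invf_le1 ?exprn_gt0// exprn_ege1//; lra.
have u : uniq (arm_sample (r, i)).
  by rewrite map_inj_uniq ?iota_uniq// => j k [].
have hm a s : a \in arm_sample (r, i) -> `|s| <= 1 / 2 ->
    (\int[P]_w (expR (s * table a w))%:E <= (expR (s * theta i + 2 * s ^+ 2))%:E)%E.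
  by move=> /mapP[j _ ->]; exact: mgf_arm.
have := mean_deviation P table (arm_sample (r, i)) (theta i) (halfwidth r) indep u h01 hm.
rewrite size_map size_iota; under eq_set do rewrite sum_arm_sample.
move=> /le_trans; apply; rewrite lee_fin; exact: quota_tail.
Qed.

(** The event concerns the reward table, sampled independently of the choices of the policy, so
    adaptivity does not bias the estimates. In the union bound the sum over arms cancels [n], and
    the sum over rounds telescopes to at most [delta] for any [fuel]. *)
Lemma good_event : exists E : set Omega,
  [/\ measurable E, ((1 - delta)%:E <= P E)%E &
    forall w, E w -> forall r i, (r < fuel)%N ->
      `|table_estimate N (fun i j => X i j w) r i - theta i| <= halfwidth r].
Proof.
pose s := [seq (r, i) | r <- index_iota 0 fuel, i <- enum 'I_n].
have [mB PB] := union_bound P _ s deviates _ (fun p _ => measurable_deviates p)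
  (fun p _ => deviates_le p).
set B := [set w | _] in mB PB.
have n0 : 0 < n%:R :> R by rewrite ltr0n ltnW.
exists (~` B); split; first exact: measurableC.
  rewrite probability_setC// EFinB leeB//; apply: (le_trans PB); rewrite lee_fin.
  rewrite big_allpairs_dep/=.
  have inner (r : nat) : \sum_(i <- enum 'I_n) delta / n%:R * (r.+1%:R^-1 - r.+2%:R^-1)
      = delta * (- r.+2%:R^-1 - - r.+1%:R^-1) :> R.
    rewrite big_enum/= sumr_const card_ord -[LHS]mulr_natr mulrAC divfK ?gt_eqF//.
    by rewrite opprK [in RHS]addrC.
  under eq_bigr do rewrite inner.
  rewrite -mulr_sumr telescope_sumr// invr1 opprK.
  by rewrite ler_piMr ?(ltW delta_gt0)// gerDr oppr_le0 invr_ge0.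
move=> w; rewrite /B/= => nB r i rf; rewrite leNgt; apply/negP => dev; apply: nB.
exists (r, i); first by apply/allpairsP; exists (r, i); rewrite mem_index_iota mem_enum.
have N0 : 0 < (N r)%:R :> R by rewrite ltr0n.
rewrite /deviates/= -(ltr_pM2l N0) in dev *.
move: dev; rewrite -[X in X * `|_|](ger0_norm (ltW N0)) -normrM mulrBr /table_estimate.
by rewrite [_ * (_ / _)]mulrC divfK ?gt_eqF.
Qed.

End good_event.

(** * Combination of the good event with the bound on the pulls of each arm *)

Theorem theorem2p1 :
  exists C : nat, (0 < C)%N /\ forall R : realType,
  exists A : algorithm R,
  forall (n K : nat) (eps delta : R),
    (2 <= n)%N -> (1 <= K <= n.-1)%N ->
    0 < eps <= 1 -> 0 < delta <= 1 / 2 ->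
  forall (D : 'I_n -> probability R R),
    (forall i, D i `[0%R, 1%R]%classic = 1%E) ->
  let theta := fun i => fine (\int[D i]_x (x%:E)) in
  forall (d : measure_display) (Omega : measurableType d)
    (P : probability Omega R)
    (X : 'I_n -> nat -> {RV P >-> R}) (U : {RV P >-> R}),
    (forall i j B, measurable B -> P (X i j @^-1` B) = D i B) ->
    (forall B, measurable B ->
       P (U @^-1` B) = lebesgue_measure (B `&` `[0%R, 1%R]%classic)) ->
    mutually_independent P
      (fun a : option ('I_n * nat) =>
         match a with None => U | Some ij => X ij.1 ij.2 end) ->
  exists E : set Omega, measurable E /\ ((1 - delta)%:E <= P E)%E /\
    forall w, E w ->
      exists (k : nat) (T : {set 'I_n}),
        A n K eps delta (U w)
          (run_hist (A n K eps delta (U w)) (fun i j => X i j w) k) = Stop T /\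
        eps_topK K eps theta T /\
        (size (run_hist (A n K eps delta (U w)) (fun i j => X i j w) k))%:R
          <= sample_bound C%:R K eps delta theta.
Proof.
(* The factors are 9 from [quota_le], 8 from [confidence_le] and 256 from [reached_cost]. *)
exists (72 * 256)%N; split; first by rewrite muln_gt0.
move=> R; exists (fun n K eps delta _ h => policy (horizon eps) (quota n delta) K eps h).
move=> n K eps delta n2 /andP[K0 Kn1] /andP[eps0 eps1] /andP[delta0 delta2] D D01 theta.
move=> d Omega P X U lawX _ indep.
have Kn : (K < n)%N by rewrite -(ltn_predK n2).
have [E [mE PE good]] := good_event delta (horizon eps) D n2 delta0 D01 P X U lawX indep.
exists E; split => //; split => // w /good{}good.
have theta01 i : 0 <= theta i <= 1 by exact: mean_itv01.
have enough := horizon_enough eps eps0.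
set N := quota n delta in good *.
set e := table_estimate N _ in good.
pose cost i := cost_term K eps theta (rank theta i).
pose L := ln (ln (4 / Delta_eps K eps theta)) + ln n%:R + ln delta^-1.
pose bound i := (72 * 256)%:R * L * cost i.
have quota_bound r i : (forall s, (s < r)%N -> ~~ settled K eps e s) ->
    i \in (rounds K e r).1 -> (N r)%:R <= bound i.
  move=> rr iS.
  have Dr := reached_Delta _ _ _ K0 Kn eps0 eps1 theta01 _ _ enough good _ rr.
  have cr := reached_cost _ _ _ K0 Kn eps0 eps1 theta01 _ _ enough good _ _ rr iS.
  have /andP[De D1] := Delta_eps_bounds _ _ _ K0 Kn eps0 eps1 theta01.
  have D0 := lt_le_trans eps0 De.
  have Lr : confidence n delta r <= 8 * L.
    by apply: confidence_le => //; rewrite D0.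
  have c1 := confidence_ge1 n delta n2 delta0 delta2 r.
  apply: (le_trans (quota_le n delta n2 delta0 delta2 r)).
  rewrite /bound natrM.
  have h1 : 4 ^+ r * confidence n delta r <= (256 * cost i) * (8 * L).
    by apply: ler_pM => //; [lra|rewrite mulrC -ler_pdivrMr].
  rewrite -mulrA (le_trans (ler_wpM2l _ h1))// le_eqVlt; apply/orP; left; apply/eqP; ring.
have bound0 r i : (forall s, (s < r)%N -> ~~ settled K eps e s) ->
    i \in (rounds K e r).1 -> 0 <= bound i.
  by move=> rr iS; exact: le_trans (quota_bound _ _ rr iS).
(* The pulls of arm [i] are capped by the integer part of [bound i]: a quota is an integer, so being
   below [bound i] is being below its integer part. *)
have [k [r [rr sr stop size_le]]] := run_terminates _ N _ _ (fun i j => X i j w) enough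
  (fun i => Num.truncn (bound i)) (fun r i rr iS =>
    etrans (truncn_ge_nat _ (bound0 r i rr iS)) (quota_bound r i rr iS)).
exists k, (verdict K e r); split => //; split.
  exact: (reached_verdict _ _ _ K0 Kn eps0 _ _ enough good).
(* Every arm is undecided in round 0, which is reached vacuously. *)
have b0 i : 0 <= bound i by apply: (bound0 0%N) => //=; rewrite inE.
apply: (@le_trans _ _ (\sum_i bound i)).
  apply: (@le_trans _ _ (\sum_i (Num.truncn (bound i)))%N%:R); first by rewrite ler_nat.
  by rewrite natr_sum; apply: ler_sum => i _; rewrite truncn_le.
rewrite /sample_bound (sum_top_arms theta _ _ (leqnn n)) -mulr_sumr.
rewrite le_eqVlt; apply/orP; left; apply/eqP; congr (_ * _).
by apply: eq_bigl => i; rewrite in_top_arms rank_le.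
Qed.
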